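(* Let $N\ge1$, $a=b=c=d=0$, $\theta_1,\theta_2\in(0,1]$, and $q=\theta_1/\theta_2$. In the interacting particle system of the six-vertex model on the strip of width $N$ on any down-right path, the total number of particles $\sum_i\tau_i$ is preserved. Moreover, for every $0\le k\le N$ and every down-right path $\mathcal P$, the following probability measure $\mu_k$ on $\{0,1\}^N$, supported on configurations with exactly $k$ particles, is a stationary measure of the six-vertex model on the strip on $\mathcal P$: the state in which the $k$ particles are at sites $1\le m_1<\dots<m_k\le N$ has probability $$\frac{q^{-\sum_{j=1}^k m_j}}{\sum_{1\le \ell_1<\dots<\ell_k\le N}q^{-\sum_{j=1}^k \ell_j}}.$$
   Context: Strip and paths. Fix an integer $N\ge 1$. The strip of width $N$ is $\{(x,y)\in\mathbb Z^2: 0\le y\le x\le y+N\}$, with an edge between any two of its vertices at distance 1; each edge can carry at most one (up or right) arrow. Vertices $(y,y)$ are left boundary vertices, $(y+N,y)$ are right boundary vertices, all others are bulk vertices. The left/bottom edges at a vertex (those lying in the strip) are its incoming edges, the right/top ones its outgoing edges. Thus a left boundary vertex has at most a bottom incoming edge and a right outgoing edge; a right boundary vertex has a left incoming edge and a top outgoing edge. A down-right path $\mathcal P$ is a path in the strip from a left boundary vertex to a right boundary vertex with each step going down or right by 1 (so it has $N$ steps). Its outgoing edges are the edges going up or right from a vertex of $\mathcal P$ to a vertex not on $\mathcal P$; there are exactly $N$, labelled $p_1,\dots,p_N$ from up-left to down-right ($p_i$ is the unique one joining the lines $x-y=i-1$ and $x-y=i$). An outgoing configuration of $\mathcal P$ is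 $\tau=(\tau_1,\dots,\tau_N)\in\{0,1\}^N$, $\tau_i=1$ iff $p_i$ carries an arrow; then we say there is a particle at site $i$. Six-vertex dynamics. Let $\mathcal Q$ be a down-right path lying (weakly) above $\mathcal P$. Given an outgoing configuration of $\mathcal P$, sample sequentially the outgoing edges of all vertices between $\mathcal P$ and $\mathcal Q$, including those on $\mathcal Q$ and excluding those on $\mathcal P$, in order of increasing $y$ and, for equal $y$, increasing $x$, independently given the incoming edges, as follows. Bulk vertex: if both (resp. neither) incoming edges carry arrows, both (resp. neither) outgoing edges do; if only the left incoming edge carries an arrow, it exits to the right with probability $\theta_2$ and to the top with probability $1-\theta_2$; if only the bottom incoming edge carries an arrow, it exits to the top with probability $\theta_1$ and to the right with probability $1-\theta_1$. Left boundary vertex: if the bottom edge carries an arrow, the right edge carries one with probability $1-c$ (none with probability $c$); if the bottom edge is empty, the right edge carries an arrow with probability $a$ (none with probability $1-a$). Right boundary vertex: if the left edge carries an arrow, the top edge carries one with probability $1-b$ (none with probability $b$); if the left edge is empty, the top edge carries an arrow with probability $d$ (none with probability $1-d$). (With $a=b=c=d=0$ every arrow reaching the boundary bounces back and no arrows are created at the boundary: ''reflecting'' boundary.) This defines a transition matrix $P_{\mathcal P,\mathcal Q}(\tau,\tau')$ from outgoing configurations of $\mathcal P$ to those of $\mathcal Q$. Particle system on $\mathcal P$. Let $\mathcal P_k=\mathcal P+(k,k)$. The interacting particle system of the six-vertex model on the strip on $\mathcal P$ is the time-homogeneous Markov chain on $\{0,1\}^N$ with transition matrix $P_{\mathcal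 P_k,\mathcal P_{k+1}}=P_{\mathcal P,\mathcal P_1}$. A stationary measure of this chain is called a stationary measure of the six-vertex model on a strip on $\mathcal P$ (it need not be unique here). *)

(* Defs.v *)
From mathcomp Require Import all_boot all_order all_algebra.

Set Implicit Arguments.
Unset Strict Implicit.
Unset Printing Implicit Defensive.

Import Order.TTheory GRing.Theory Num.Theory.
Local Open Scope ring_scope.

(* A vertex (x, y); the strip has 0 <= y <= x, so natural coordinates suffice. *)
Definition vertex : Type := (nat * nat)%type.

(* An edge is a pair (tail, head), oriented up or right. *)
Definition edge : Type := (vertex * vertex)%type.

Definition top_edge (v : vertex) : edge := (v, (v.1, v.2.+1)).
Definition right_edge (v : vertex) : edge := (v, (v.1.+1, v.2)).

(* Only meaningful when v.1 > 0, resp. v.2 > 0; this always holds where they are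
   used, since the sampled vertices lie strictly above a path in the strip. *)
Definition left_edge (v : vertex) : edge := ((v.1.-1, v.2), v).
Definition bottom_edge (v : vertex) : edge := ((v.1, v.2.-1), v).

Section Strip.
Variable N : nat.

Definition in_strip (v : vertex) : bool := (v.2 <= v.1 <= v.2 + N)%N.
Definition left_boundary (v : vertex) : bool := v.1 == v.2.
Definition right_boundary (v : vertex) : bool := v.1 == (v.2 + N)%N.

Definition down_right_step (u v : vertex) : bool :=
  ((v.1, v.2.+1) == u) || (v == (u.1.+1, u.2)).

Definition down_right_path (P : seq vertex) : bool :=
  if P is v :: s then
    [&& all in_strip P, left_boundary v, path down_right_step v s
      & right_boundary (last v s)]
  else false.

Definition shift (k : nat) (P : seq vertex) : seq vertex :=
  [seq ((v.1 + k)%N, (v.2 + k)%N) | v <- P].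

(* Vertices of P are listed from up-left to down-right.  The top edge of the
   vertex on the line x - y = j joins the lines j and j - 1, and its right edge
   the lines j and j + 1, so this list is already in the order p_1, ..., p_N. *)
Definition outgoing_edges (P : seq vertex) : seq edge :=
  [seq e <- flatten [seq [:: top_edge v; right_edge v] | v <- P]
     | in_strip e.2 && (e.2 \notin P)].

(* Sites are numbered from 0: i : 'I_N stands for the site i + 1. *)
Definition outgoing_edge (P : seq vertex) (i : 'I_N) : edge :=
  nth ((0, 0), (0, 0))%N (outgoing_edges P) i.

Definition config : finType := {ffun 'I_N -> bool}.

Definition occupied (tau : config) : {set 'I_N} := [set i | tau i].

Definition arrows_of_config (P : seq vertex) (tau : config) : edge -> bool :=
  fun e => [exists i, (e == outgoing_edge P i) && tau i].

Definition config_of_arrows (P : seq vertex) (sigma : edge -> bool) : config :=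
  [ffun i => sigma (outgoing_edge P i)].

Definition same_diagonal (u v : vertex) : bool :=
  (u.1 + v.2 == v.1 + u.2)%N.

Definition strictly_above (P : seq vertex) (v : vertex) : bool :=
  has (fun u => same_diagonal u v && (u.2 < v.2)%N) P.
Definition weakly_below (Q : seq vertex) (v : vertex) : bool :=
  has (fun u => same_diagonal u v && (v.2 <= u.2)%N) Q.

(* The vertices between P (excluded) and Q (included), by increasing y and, for
   equal y, increasing x.  The first vertex of Q has the largest y of Q and its
   last vertex the largest x. *)
Definition sampled_vertices (P Q : seq vertex) : seq vertex :=
  [seq v <- [seq (x, y) | y <- iota 0 (head (0, 0)%N Q).2.+1,
                          x <- iota 0 (last (0, 0)%N Q).1.+1]
     | [&& in_strip v, strictly_above P v & weakly_below Q v]].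

Section Dynamics.
Variables (R : realFieldType) (theta1 theta2 a b c d : R).

Definition bernoulli_weight (p : R) (x : bool) : R := if x then p else 1 - p.

(* In the weights below, l, m are the left and bottom inputs, and t, r the top
   and right outputs. *)
Definition bulk_weight (l m t r : bool) : R :=
  match l, m with
  | true, true => (t && r)%:R
  | false, false => (~~ t && ~~ r)%:R
  | true, false => (t != r)%:R * bernoulli_weight theta2 r
  | false, true => (t != r)%:R * bernoulli_weight theta1 t
  end.

(* The top edge of a left boundary vertex and the right edge of a right boundary
   vertex are not in the strip, and are kept empty. *)
Definition left_weight (m t r : bool) : R :=
  (~~ t)%:R * bernoulli_weight (if m then 1 - c else a) r.

Definition right_weight (l t r : bool) : R :=
  (~~ r)%:R * bernoulli_weight (if l then 1 - b else d) t.

Definition vertex_weight (v : vertex) (l m t r : bool) : R :=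
  if left_boundary v then left_weight m t r
  else if right_boundary v then right_weight l t r
  else bulk_weight l m t r.

Definition set_outputs (sigma : edge -> bool) (v : vertex) (t r : bool) :
    edge -> bool :=
  fun e => if e == top_edge v then t
           else if e == right_edge v then r else sigma e.

(* The probability that the final arrows satisfy E, when the vertices of vs are
   sampled one after the other starting from the arrows sigma. *)
Fixpoint sampling_prob (vs : seq vertex) (sigma : edge -> bool)
    (E : (edge -> bool) -> bool) : R :=
  if vs is v :: vs' then
    \sum_(o : bool * bool)
      vertex_weight v (sigma (left_edge v)) (sigma (bottom_edge v)) o.1 o.2
      * sampling_prob vs' (set_outputs sigma v o.1 o.2) E
  else (E sigma)%:R.

Definition transition (P Q : seq vertex) (tau tau' : config) : R :=
  sampling_prob (sampled_vertices P Q) (arrows_of_config P tau)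
    (fun sigma => config_of_arrows Q sigma == tau').

Definition particle_system (P : seq vertex) : config -> config -> R :=
  transition P (shift 1 P).

End Dynamics.

Section Measures.
Variable R : realFieldType.

Definition prob_measure (mu : config -> R) : Prop :=
  (forall tau, 0 <= mu tau) /\ \sum_tau mu tau = 1.

Definition stationary (K : config -> config -> R) (mu : config -> R) : Prop :=
  prob_measure mu /\ forall tau', \sum_tau mu tau * K tau tau' = mu tau'.

(* The sum of the sites in A, the element i : 'I_N being the site i + 1. *)
Definition site_sum (A : {set 'I_N}) : nat := (\sum_(i in A) i.+1)%N.

(* Increasing k-tuples of sites are encoded as sets of k sites. *)
Definition mu_k (q : R) (k : nat) (tau : config) : R :=
  if #|occupied tau| == k then
    q ^- site_sum (occupied tau)
    / \sum_(A : {set 'I_N} | #|A| == k) q ^- site_sum A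
  else 0.

End Measures.
End Strip.

(* Main.v *)
Require Import Defs.
From mathcomp Require Import all_boot all_order all_algebra perm zify ring.
Import Order.TTheory GRing.Theory Num.Theory.
Set Implicit Arguments.
Unset Strict Implicit.
Unset Printing Implicit Defensive.
Local Open Scope ring_scope.

(** Why the theorem is true.

    Call j = x - y the line of a vertex (x, y).  A down-right path has exactly
    one vertex on each line 0, ..., N, and its site i is the edge that crosses
    from line i to line i + 1, so a path may be treated as a function from lines
    to vertices.  Going from P to P + (1, 1), the sampled vertices are exactly
    those of P + (1, 1).  They are visited by increasing y and then increasing
    x, and this order moves the path one corner at a time: when v is visited,
    the current path turns below v through v - (1, 1), so that the incoming
    edges of v are the current sites j - 1 and j (numbered from 0), and replacing
    v - (1, 1) by v turns the outgoing edges of v into the new sites j - 1 and j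
    (path_sweep).

    Sampling a vertex therefore acts on the configuration of the current path.
    Since arrows are conserved at a vertex, the only possible change is that the
    two sites exchange their contents.  In the bulk this happens with
    probability theta2 if the left site alone is occupied and theta1 if the
    right one alone is; with reflecting boundary, boundary vertices change
    nothing (vertex_exchange).  The particle system is thus a product of
    random nearest-neighbour exchanges, in an order that depends on the path
    (particle_system_exchange).

    Exchanges preserve the number of particles.  Moving a particle one site to
    the right divides q ^- site_sum by q = theta1 / theta2, which is precisely
    the ratio required for detailed balance (detailed_balance).  Each exchange is
    then reversible for this weight, so every product of them leaves it
    invariant, whatever the path (exchange_chain_weight).  Conservation of
    particles allows the weight to be restricted to k particles and normalized. *)

(** * Sites of a path and corner flips *)

(** The outgoing edge of a path between lines i and i + 1 is determined by the two
    vertices of the path on these lines.  This makes the effect of moving one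
    vertex visible, which the filtered list of all outgoing edges does not. *)
Definition crossing_edge (u : nat -> vertex) (i : nat) : edge :=
  if (u i).2 == (u i.+1).2 then top_edge (u i.+1) else right_edge (u i).

Definition on_lines (N : nat) (u : nat -> vertex) : Prop :=
  forall i, (i <= N)%N -> (u i).1 = ((u i).2 + i)%N.

Lemma crossing_edge_inj N u i k : on_lines N u -> (i < N)%N -> (k < N)%N ->
  crossing_edge u i = crossing_edge u k -> i = k.
Proof.
move=> hu hi hk; rewrite /crossing_edge.
have [hi1 hk1] := (hu i (ltnW hi), hu k (ltnW hk)).
have [hi2 hk2] := (hu _ hi, hu _ hk).
by do 2!case: ifP => _; rewrite /top_edge /right_edge => -[e *];
  have := (congr1 fst e, congr1 snd e) => -[/= e1 e2]; lia.
Qed.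

Definition flip (u : nat -> vertex) (j : nat) (v : vertex) : nat -> vertex :=
  fun i => if i == j then v else u i.

(** The vertices of the list can be visited one after the other, each by a
    corner flip of the current path.  Visiting (y + j + 1, y + 1) requires the
    current path to pass through (y + j, y + 1), (y + j, y), (y + j + 1, y), as
    far as these lie in the strip. *)
Inductive sweep (N : nat) :
    (nat -> vertex) -> seq vertex -> (nat -> vertex) -> Prop :=
| sweep_nil u u' : (forall j, (j <= N)%N -> u j = u' j) -> sweep N u [::] u'
| sweep_cons u j y vs u' : (j <= N)%N -> u j = (y + j, y)%N ->
    ((0 < j)%N -> u j.-1 = (y + j, y.+1)%N) ->
    ((j < N)%N -> u j.+1 = ((y + j).+1, y)%N) ->
    sweep N (flip u j ((y + j).+1, y.+1)%N) vs u' ->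
    sweep N u (((y + j).+1, y.+1)%N :: vs) u'.

Lemma flip_on_lines N u j y : on_lines N u ->
  on_lines N (flip u j ((y + j).+1, y.+1)%N).
Proof. by move=> hu i hi; rewrite /flip; case: eqP => [->|_] //=; apply: hu. Qed.

Section Flip.
Variables (N : nat) (u : nat -> vertex) (j y : nat).
Hypotheses (hu : on_lines N u) (hj : (j <= N)%N) (huj : u j = (y + j, y)%N).
Hypothesis hleft : (0 < j)%N -> u j.-1 = (y + j, y.+1)%N.
Hypothesis hright : (j < N)%N -> u j.+1 = ((y + j).+1, y)%N.
Let v : vertex := ((y + j).+1, y.+1)%N.

Lemma left_edge_crossing : (0 < j)%N -> left_edge v = crossing_edge u j.-1.
Proof.
move=> j0; rewrite /crossing_edge prednK // hleft // huj /=.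
by case: eqP => [/=|_]; [lia | rewrite /left_edge /right_edge].
Qed.

Lemma bottom_edge_crossing : (j < N)%N -> bottom_edge v = crossing_edge u j.
Proof. by move=> jN; rewrite /crossing_edge huj hright //= eqxx. Qed.

(** After a flip, the outgoing edges of the new vertex are the two sites next to
    line j of the new path, and no other site is affected, because edges between
    different pairs of lines are different. *)
Lemma set_outputs_crossing sigma t r i : (i < N)%N ->
  set_outputs sigma v t r (crossing_edge (flip u j v) i) =
  if i.+1 == j then t else if i == j then r else sigma (crossing_edge u i).
Proof.
move=> hi; case: (eqVneq i.+1 j) => [ij|nij].
  have ui : u i = (y + j, y.+1)%N by rewrite -hleft -ij.
  have e1 : flip u j v i = u i by rewrite /flip; case: eqP => //; lia.
  have e2 : flip u j v i.+1 = v by rewrite /flip ij eqxx.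
  by rewrite /crossing_edge e1 e2 ui /= eqxx /set_outputs eqxx.
have e2 : flip u j v i.+1 = u i.+1 by rewrite /flip (negbTE nij).
case: (eqVneq i j) => [ij|nij'].
  have e1 : flip u j v i = v by rewrite /flip ij eqxx.
  rewrite /crossing_edge e1 e2 ij hright -?ij // /=.
  case: eqP => [|_]; first lia.
  rewrite /set_outputs eqxx; case: eqP => // -[]; lia.
have e1 : flip u j v i = u i by rewrite /flip (negbTE nij').
have -> : crossing_edge (flip u j v) i = crossing_edge u i.
  by rewrite /crossing_edge e1 e2.
have [h1 h2] := (hu (ltnW hi), hu hi).
have coords (e e' : edge) : e = e' ->
    [/\ e.1.1 = e'.1.1, e.1.2 = e'.1.2, e.2.1 = e'.2.1 & e.2.2 = e'.2.2] by move->.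
have /negbTE ntop : crossing_edge u i != top_edge v.
  by apply/eqP; rewrite /crossing_edge; case: ifP => _ /coords[/=]; lia.
have /negbTE nright : crossing_edge u i != right_edge v.
  by apply/eqP; rewrite /crossing_edge; case: ifP => _ /coords[/=]; lia.
by rewrite /set_outputs ntop nright.
Qed.

End Flip.

(** * The sampled vertices sweep a down-right path by corner flips *)

Definition vertex_of (P : seq vertex) (i : nat) : vertex := nth (0, 0)%N P i.
Arguments vertex_of : simpl never.

Lemma vertex_ofP (P : seq vertex) (v : vertex) :
  reflect (exists2 i, (i < size P)%N & vertex_of P i = v) (v \in P).
Proof. exact: nthP. Qed.

Section Path.
Variables (N : nat) (P : seq vertex).
Hypothesis hP : down_right_path N P.
Local Notation p := (vertex_of P).

(** Each step of the path increases x - y by one, so the vertex at position i is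
    the one on line i, and the right boundary is reached after N steps. *)
Lemma path_facts : [/\ size P = N.+1, on_lines N p &
  forall i, (i < N)%N -> p i = ((p i.+1).1, (p i.+1).2.+1)
                      \/ p i.+1 = ((p i).1.+1, (p i).2)].
Proof.
case: P hP => // v s /and4P[_ /eqP hv /(pathP (0, 0)%N) hs /eqP hl].
have step i : (i < size s)%N -> down_right_step (vertex_of (v :: s) i)
    (vertex_of (v :: s) i.+1) by apply: hs.
have {}step i : (i < size s)%N ->
    vertex_of (v :: s) i = ((vertex_of (v :: s) i.+1).1,
                            (vertex_of (v :: s) i.+1).2.+1)
    \/ vertex_of (v :: s) i.+1
       = ((vertex_of (v :: s) i).1.+1, (vertex_of (v :: s) i).2).
  by move=> /step /orP[/eqP <-|/eqP ->]; [left | right].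
have line i : (i <= size s)%N ->
    (vertex_of (v :: s) i).1 = ((vertex_of (v :: s) i).2 + i)%N.
  elim: i => [|i IH] hi; first by rewrite addn0.
  by have := IH (ltnW hi); case: (step i hi) => ->; simpl; lia.
have sz : size s = N.
  have := line _ (leqnn _); rewrite /vertex_of -[size s]/(size (v :: s)).-1.
  by rewrite nth_last /= hl => /addnI.
by split; rewrite -?sz //= => i; apply: line.
Qed.

Lemma mem_path (v : vertex) : (v \in P) = in_strip N v && (p (v.1 - v.2)%N == v).
Proof.
have [sz line _] := path_facts.
apply/idP/andP => [/vertex_ofP[i]|[/andP[h1 h2] /eqP <-]].
  rewrite sz ltnS => hi <-; have e := line i hi; split.
    by rewrite /in_strip e; lia.
  by apply/eqP; congr vertex_of; lia.
by apply: mem_nth; rewrite sz; lia.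
Qed.

(** Along the path, the candidates come in groups, the right edge of a vertex
    followed by the top edge of the next one; if the filter keeps exactly one
    candidate of each group, namely the one that leaves the path, then the
    surviving list has one edge per step. *)
Lemma flatten_outgoing (a : pred edge) v s :
  (forall i, (i < size s)%N ->
     a (right_edge (vertex_of (v :: s) i))
       = ((vertex_of (v :: s) i).2 != (vertex_of s i).2)
     /\ a (top_edge (vertex_of s i))
       = ((vertex_of (v :: s) i).2 == (vertex_of s i).2)) ->
  a (right_edge (last v s)) = false ->
  [seq e <- right_edge v :: flatten [seq [:: top_edge w; right_edge w] | w <- s]
     | a e]
  = pairmap (fun x y => if x.2 == y.2 then top_edge y else right_edge x) v s.
Proof.
elim: s v => [|w s IH] v h hl; first by rewrite /= in hl *; rewrite hl.
have [/= hr ht] := h 0%N isT.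
rewrite /= in IH *; rewrite hr ht -(IH w) //; last by move=> i; apply: (h i.+1).
by case: eqP.
Qed.

(** An outgoing edge leaves the path because its head is not the vertex of the
    path on the line of that head.  So a right step is crossed by the top edge of
    its end and a down step by the right edge of its start, in path order. *)
Lemma outgoing_edge_crossing (i : 'I_N) :
  outgoing_edge P i = crossing_edge p i.
Proof.
have [sz line step] := path_facts.
rewrite /outgoing_edge /outgoing_edges.
set a := fun e : edge => _.
have aE e : a e = in_strip N e.2 && (p (e.2.1 - e.2.2)%N != e.2).
  by rewrite /a mem_path; case: in_strip.
have aright k : (k < N)%N -> a (right_edge (p k)) = ((p k).2 != (p k.+1).2).
  move=> hk; have [l1 l2] := (line k (ltnW hk), line _ hk).
  rewrite aE /in_strip /= (_ : ((p k).1.+1 - (p k).2 = k.+1)%N); last by lia.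
  rewrite (_ : (_ <= _ <= _)%N = true); last by lia.
  rewrite /=; case: (step k hk) => e; rewrite e /= ?eqxx //.
  by rewrite [RHS](_ : _ = true); [apply/eqP => /(congr1 fst) /= | ]; lia.
have atop k : (k < N)%N -> a (top_edge (p k.+1)) = ((p k).2 == (p k.+1).2).
  move=> hk; have [l1 l2] := (line k (ltnW hk), line _ hk).
  rewrite aE /in_strip /= (_ : ((p k.+1).1 - (p k.+1).2.+1 = k)%N); last by lia.
  rewrite (_ : (_ <= _ <= _)%N = true); last by lia.
  rewrite /=; case: (step k hk) => e; rewrite ?e ?eqxx /=.
    by apply/esym/eqP; lia.
  by apply/eqP => /(congr1 snd) /=; lia.
have afirst : a (top_edge (p 0)) = false.
  by have := line 0%N isT; rewrite aE /in_strip /=; case: leqP => //; lia.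
have alast : a (right_edge (p N)) = false.
  by have := line N (leqnn _); rewrite aE /in_strip /= => ->; case: andP => //; lia.
clearbody a; move: sz aright atop afirst alast; clear.
case: P => // v s [sz] aright atop; rewrite {1}/vertex_of /= => afirst alast.
have /= := flatten_outgoing (a := a) (v := v) (s := s).
rewrite afirst => ->; rewrite ?sz.
- by rewrite (nth_pairmap (0, 0)%N) ?sz // /crossing_edge.
- by move=> k hk; split; [apply: aright | apply: atop].
- by rewrite (last_nth (0, 0)%N) sz.
Qed.

Lemma shift_path : down_right_path N (shift 1 P).
Proof.
case: P hP => // v s /and4P[h1 /eqP h2 h3 /eqP h4]; apply/and4P; split.
- rewrite all_map; apply: sub_all h1 => w; rewrite /in_strip /=; lia.
- by rewrite /left_boundary /= h2.
- rewrite path_map; apply: sub_path h3 => x y.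
  rewrite /down_right_step /= => /orP[/eqP <-|/eqP ->]; apply/orP;
  [left|right]; apply/eqP; congr pair; simpl; lia.
- by rewrite last_map /right_boundary /= h4 addnAC.
Qed.

Lemma shift_nth i : (i <= N)%N -> vertex_of (shift 1 P) i = ((p i).1.+1, (p i).2.+1).
Proof.
have [sz _ _] := path_facts => hi.
by rewrite /vertex_of (nth_map (0, 0)%N) ?sz // !addn1.
Qed.

(** A vertex strictly above P and weakly below P + (1, 1) lies on the line of a
    single vertex of P, and hence is the translate of that vertex. *)
Lemma mem_sampled_vertices (v : vertex) :
  (v \in sampled_vertices N P (shift 1 P)) = (v \in shift 1 P).
Proof.
have [sz line step] := path_facts.
have up (w : vertex) : w \in P -> exists2 i, (i <= N)%N & w = p i.
  by move=> /vertex_ofP[i]; rewrite sz => hi <-; exists i.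
have mono i k : (i <= k <= N)%N -> ((p i).1 <= (p k).1)%N /\ ((p k).2 <= (p i).2)%N.
  move=> /andP[ik kN]; elim: k ik kN => [|k IH]; first by case: i.
  rewrite leq_eqVlt => /orP[/eqP -> //|/IH{}IH kN].
  have [h1 h2] := IH (ltnW kN).
  by case: (step k kN) => e; move: h1 h2; rewrite e /=; lia.
rewrite mem_filter; apply/idP/idP.
  move=> /andP[/and3P[_ /hasP[u uP /andP[/eqP d1 lt1]]
    /hasP[w' /mapP[w wP ->] /andP[/eqP d2 lt2]]] _].
  have [[i hi ui] [k hk wk]] := (up u uP, up w wP); subst u w.
  have [li lk] := (line i hi, line k hk); move: d1 d2 lt1 lt2 => /= d1 d2 lt1 lt2.
  have ik : i = k by lia.
  subst k; apply/mapP; exists (p i) => //.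
  by rewrite [LHS]surjective_pairing; congr pair; lia.
move=> vS; have /mapP[u /up[i hi ->] vE] := vS.
have li := line i hi.
apply/andP; split.
  apply/and3P; split.
  - by rewrite /in_strip vE /=; lia.
  - apply/hasP; exists (p i); first by rewrite mem_nth ?sz.
    by rewrite /same_diagonal vE /=; apply/andP; split; [apply/eqP|]; lia.
  - apply/hasP; exists v => //.
    by rewrite /same_diagonal eqxx leqnn.
have hd : head (0, 0)%N (shift 1 P) = vertex_of (shift 1 P) 0 by rewrite /vertex_of nth0.
have tl : last (0, 0)%N (shift 1 P) = vertex_of (shift 1 P) N.
  by rewrite /vertex_of -nth_last size_map sz.
have [m1 _] := mono i N ltac:(lia); have [_ m2] := mono 0%N i ltac:(lia).
apply/allpairsP; exists (v.2, v.1); rewrite !mem_iota hd tl !shift_nth // vE /=.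
by split; rewrite ?addn1 //; lia.
Qed.

Definition sampled_before (v w : vertex) : bool :=
  (v.2 < w.2)%N || ((v.2 == w.2) && (v.1 < w.1)%N).

Lemma sampled_vertices_sorted Q : pairwise sampled_before (sampled_vertices N P Q).
Proof.
rewrite /sampled_vertices; set f := fun v : vertex => _.
rewrite pairwise_filter //.
have iota_lt m k : pairwise ltn (iota m k).
  by rewrite -sorted_pairwise ?iota_ltn_sorted //; apply: ltn_trans.
move: (iota 0 _) (iota_lt 0%N (head (0, 0)%N Q).2.+1) => ys.
move: (iota 0 _) (iota_lt 0%N (last (0, 0)%N Q).1.+1) => xs hxs.
elim: ys => [|y ys IH] //= /andP[hy hys].
rewrite pairwise_cat IH // andbT; apply/andP; split.
  apply/allrelP => _ _ /mapP[x _ ->] /allpairsP[[y' x'] [/= hy' _ ->]].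
  by rewrite /sampled_before /=; have /= -> := allP hy _ hy'.
rewrite pairwise_map; apply: sub_pairwise hxs => x x' h.
by rewrite /sampled_before /= eqxx ltnn.
Qed.

(** At each stage the current path passes, on every line, through the translated
    vertex if it was already visited and through the vertex of P otherwise.  The
    corner needed for the next flip is there because the sampling order visits the
    left neighbour (same y, smaller x) and the lower neighbour (smaller y) of a
    vertex before it, and its upper and right neighbours after it. *)
Lemma path_sweep :
  sweep N p (sampled_vertices N P (shift 1 P)) (vertex_of (shift 1 P)).
Proof.
have [sz line step] := path_facts.
pose up (v : vertex) : vertex := (v.1.+1, v.2.+1).
suff gen vs' done u : sampled_vertices N P (shift 1 P) = done ++ vs' ->
    (forall j, (j <= N)%N -> u j = if up (p j) \in done then up (p j) else p j) ->
    sweep N u vs' (vertex_of (shift 1 P)).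
  exact: (gen _ [::]).
have sampled j : (j <= N)%N -> up (p j) \in sampled_vertices N P (shift 1 P).
  move=> hj; rewrite mem_sampled_vertices /up -shift_nth //.
  by apply/vertex_ofP; exists j; rewrite ?size_map ?sz.
elim: vs' done u => [|v vs' IH] done u eS hu.
  apply: sweep_nil => j hj; rewrite hu // shift_nth //.
  by have := sampled j hj; rewrite eS cats0 => ->.
have := sampled_vertices_sorted (shift 1 P).
rewrite eS pairwise_cat /= => /and3P[/allrelP cross _ /andP[/allP later _]].
have done_before (w : vertex) : w \in done -> sampled_before w v.
  by move=> hw; apply: cross => //; rewrite mem_head.
have before_done j : (j <= N)%N -> sampled_before (up (p j)) v -> up (p j) \in done.
  move=> /sampled; rewrite eS mem_cat in_cons => /or3P[//|/eqP ->|/later].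
    by rewrite /sampled_before !ltnn andbF.
  by rewrite /sampled_before; lia.
have [j hj vE] : exists2 j, (j <= N)%N & v = up (p j).
  have : v \in shift 1 P by rewrite -mem_sampled_vertices eS mem_cat mem_head orbT.
  case/vertex_ofP => j; rewrite size_map sz ltnS => hj <-.
  by exists j => //; rewrite shift_nth.
have pj : p j = ((p j).2 + j, (p j).2)%N.
  by rewrite -(line j hj) -surjective_pairing.
set y := (p j).2 in pj.
have vy : v = ((y + j).+1, y.+1)%N by rewrite vE pj.
rewrite vy; apply: sweep_cons => //.
- rewrite hu // -vE; case: ifP => // /done_before.
  by rewrite /sampled_before !ltnn andbF.
- move=> j0; have jN : (j.-1 < N)%N by lia.
  have hj1 : (j.-1 <= N)%N := ltnW jN.
  (* A down step before line j: the previous translated vertex is higher and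
     not yet visited; a right step: it is the left neighbour, already visited. *)
  have := step _ jN; rewrite prednK // pj /= => -[e|[e1 e2]].
    rewrite hu // e; case: ifP => // /done_before.
    by rewrite vy /sampled_before /=; lia.
  have upE : up (p j.-1) = (y + j, y.+1)%N by rewrite /up -e1 -e2.
  rewrite hu // upE ifT // -upE; apply: before_done => //.
  by rewrite upE vy /sampled_before /=; lia.
- move=> jN.
  (* A down step after line j: the next translated vertex is the lower
     neighbour, already visited; a right step: it is still to come. *)
  case: (step _ jN); rewrite pj => e.
    case: e => e1 e2.
    have upE : up (p j.+1) = ((y + j).+1, y)%N by rewrite /up -e1 -e2.
    rewrite hu // upE ifT // -upE; apply: before_done => //.
    by rewrite upE vy /sampled_before /=; lia.
  rewrite hu // e; case: ifP => // /done_before.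
  by rewrite vy /sampled_before /=; lia.
- rewrite -vy; apply: (IH (rcons done v)); first by rewrite cat_rcons.
  move=> k hk; rewrite /flip mem_rcons in_cons.
  case: eqVneq => [->|nkj]; first by rewrite vE eqxx.
  rewrite hu //; case: eqP => // e.
  have := line k hk; move: e; rewrite vy => -[-> ->] /=; move/eqP: nkj; lia.
Qed.
End Path.

(** * A sampled vertex exchanges two neighbouring sites *)

Section Exchange.
Variables (n : nat) (R : realFieldType) (theta1 theta2 : R).
Local Notation N := n.+1.

Definition read (u : nat -> vertex) (sigma : edge -> bool) : config N :=
  [ffun i : 'I_N => sigma (crossing_edge u i)].

(** Meaningful for 0 < j < N.  On the two boundary lines the indices are default
    values, but there exchange_prob is 0. *)
Definition exchange (j : nat) (eta : config N) : config N :=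
  [ffun i => eta (tperm (inord j.-1) (inord j) i)].

Definition exchange_prob (j : nat) (eta : config N) : R :=
  if (0 < j < N)%N then
    match eta (inord j.-1), eta (inord j) with
    | true, false => theta2
    | false, true => theta1
    | _, _ => 0
    end
  else 0.

Fixpoint exchange_chain (js : seq nat) (eta tau' : config N) : R :=
  if js is j :: js' then
    (1 - exchange_prob j eta) * exchange_chain js' eta tau'
    + exchange_prob j eta * exchange_chain js' (exchange j eta) tau'
  else (eta == tau')%:R.

(** The outputs of a bulk vertex are its inputs in the same order or in the
    opposite order.  Top and right outputs are the sites j - 1 and j, as are the left and
    bottom inputs, so an arrow that enters from the left and exits to the right,
    or from the bottom to the top, changes site. *)
Lemma vertex_exchange (F : config N -> R) u j y sigma (v := ((y + j).+1, y.+1)%N) :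
  on_lines N u -> (j <= N)%N -> u j = (y + j, y)%N ->
  ((0 < j)%N -> u j.-1 = (y + j, y.+1)%N) ->
  ((j < N)%N -> u j.+1 = ((y + j).+1, y)%N) ->
  \sum_(o : bool * bool)
    vertex_weight N theta1 theta2 0 0 0 0 v
      (sigma (left_edge v)) (sigma (bottom_edge v)) o.1 o.2
    * F (read (flip u j v) (set_outputs sigma v o.1 o.2))
  = (1 - exchange_prob j (read u sigma)) * F (read u sigma)
    + exchange_prob j (read u sigma) * F (exchange j (read u sigma)).
Proof.
move=> hu hj huj hl hr; set eta := read u sigma.
pose upd t r : config N := [ffun i : 'I_N =>
  if i.+1 == j then t else if (i : nat) == j then r else eta i].
have readE t r : read (flip u j v) (set_outputs sigma v t r) = upd t r.
  by apply/ffunP=> i; rewrite !ffunE (set_outputs_crossing hu).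
under eq_bigr => o _ do rewrite readE.
rewrite -(pair_bigA _ (fun t r => vertex_weight N theta1 theta2 0 0 0 0 v
  (sigma (left_edge v)) (sigma (bottom_edge v)) t r * F (upd t r))) /=.
rewrite !big_bool /vertex_weight /left_boundary /right_boundary /=.
have [j0|jpos] := posnP j.
  (* Left boundary: the arrow at the first site, if any, bounces back to it. *)
  have -> : ((y + j).+1 == y.+1) = true by lia.
  have etaE : upd false (sigma (bottom_edge v)) = eta.
    apply/ffunP=> i; rewrite !ffunE (bottom_edge_crossing huj hr) // ?j0 //=.
    by case: eqP => // ->.
  rewrite /exchange_prob j0 /=; rewrite /left_weight /bernoulli_weight /=.
  by rewrite -etaE; case: (sigma _); ring.
have -> : ((y + j).+1 == y.+1) = false by lia.
have [jN|jN] := eqVneq j N.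
  (* Right boundary: likewise, the arrow at the last site bounces back. *)
  have -> : ((y + j).+1 == y.+1 + N)%N by lia.
  have etaE : upd (sigma (left_edge v)) false = eta.
    apply/ffunP=> i; rewrite !ffunE (@left_edge_crossing N u) //.
    have := ltn_ord i; case: eqP => [<-//|_ lti].
    by case: eqP => // e; lia.
  have -> : exchange_prob j eta = 0 by rewrite /exchange_prob jN ltnn andbF.
  rewrite /right_weight /bernoulli_weight /=.
  by rewrite -etaE; case: (sigma _); ring.
have -> : ((y + j).+1 == y.+1 + N)%N = false by apply/eqP; move/eqP: jN; lia.
have ltjN : (j < N)%N by rewrite ltn_neqAle jN.
have ja : (inord j.-1 : 'I_N) = j.-1 :> nat by rewrite inordK; lia.
have jb : (inord j : 'I_N) = j :> nat by rewrite inordK.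
have lE : sigma (left_edge v) = eta (inord j.-1).
  by rewrite ffunE ja (@left_edge_crossing N u).
have mE : sigma (bottom_edge v) = eta (inord j).
  by rewrite ffunE jb (bottom_edge_crossing huj hr).
have stay : upd (eta (inord j.-1)) (eta (inord j)) = eta.
  apply/ffunP=> i; rewrite ffunE; case: eqP => [e|_].
    by congr (eta _); apply: val_inj; rewrite /= ja; lia.
  by case: eqP => // e; congr (eta _); apply: val_inj; rewrite /= jb.
have swap : upd (eta (inord j)) (eta (inord j.-1)) = exchange j eta.
  apply/ffunP=> i; rewrite !ffunE; case: tpermP => [->|->|].
  - by rewrite ja prednK // eqxx.
  - by rewrite jb eqxx; case: eqP => //; lia.
  - move=> /eqP; rewrite -val_eqE /= ja => ia /eqP; rewrite -val_eqE /= jb => ib.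
    by rewrite (negbTE ib); case: eqP => // e; move/eqP: ia; lia.
rewrite lE mE /exchange_prob jpos ltjN /=.
move: stay swap; case: (eta (inord j.-1)); case: (eta (inord j)) => stay swap;
  rewrite -swap -stay /bulk_weight /bernoulli_weight /=; ring.
Qed.

(** The arrows that matter for the rest of a sweep are those on the current path,
    so the sampling process projects to a chain of exchanges. *)
Lemma sampling_prob_exchange u vs u' sigma E tau' :
  sweep N u vs u' -> on_lines N u ->
  (forall sigma', E sigma' = (read u' sigma' == tau')) ->
  sampling_prob N theta1 theta2 0 0 0 0 vs sigma E
  = exchange_chain [seq (v.1 - v.2)%N | v <- vs] (read u sigma) tau'.
Proof.
move=> hs; elim: hs sigma => {u vs u'} [u u' uu'|u j y vs u' hj huj hl hr _ IH]
  sigma hu hE /=.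
  rewrite hE; suff -> : read u sigma = read u' sigma by [].
  by apply/ffunP=> i; rewrite !ffunE /crossing_edge !uu' // ltnW.
have -> : ((y + j).+1 - y.+1 = j)%N by lia.
under eq_bigr => o _ do rewrite (IH _ (flip_on_lines j y hu) hE).
exact: (vertex_exchange (fun eta => exchange_chain _ eta tau')).
Qed.

(** * Conservation of particles and detailed balance *)

Lemma exchangeK j : involutive (exchange j).
Proof. by move=> eta; apply/ffunP=> i; rewrite !ffunE tpermK. Qed.

Lemma exchange_sum j eta :
  (\sum_(i < N) exchange j eta i = \sum_(i < N) eta i)%N.
Proof.
rewrite [RHS](reindex_inj (@perm_inj _ (tperm (inord j.-1) (inord j)))) /=.
by apply: eq_bigr => i _; rewrite ffunE.
Qed.

Lemma exchange_chain_sum js eta tau' : exchange_chain js eta tau' != 0 ->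
  (\sum_(i < N) tau' i = \sum_(i < N) eta i)%N.
Proof.
elim: js eta => [|j js IH] eta /=.
  by have [->|] := eqVneq eta tau'; rewrite ?eqxx.
have [->|/IH //] := eqVneq (exchange_chain js eta tau') 0.
rewrite mulr0 add0r mulf_eq0 negb_or => /andP[_ /IH ->].
exact: exchange_sum.
Qed.

Lemma site_sumE (eta : config N) :
  site_sum (occupied eta) = (\sum_(i < N) eta i * i.+1)%N.
Proof.
rewrite /site_sum big_mkcond; apply: eq_bigr => i _.
by rewrite inE; case: (eta i); rewrite ?mul1n ?mul0n.
Qed.

(** Written additively because sites are natural numbers: the site sum grows by one
    when a particle moves right and drops by one when it moves left. *)
Lemma site_sum_exchange j eta : (0 < j < N)%N ->
  (site_sum (occupied (exchange j eta)) + eta (inord j) =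
   site_sum (occupied eta) + eta (inord j.-1))%N.
Proof.
move=> /andP[j0 jN]; set a : 'I_N := inord j.-1; set b : 'I_N := inord j.
have ja : a = j.-1 :> nat by rewrite inordK; lia.
have jb : b = j :> nat by rewrite inordK.
have ab : b != a by rewrite -val_eqE /= ja jb; lia.
have sumE (f : config N) : site_sum (occupied f) = (f a * a.+1 + (f b * b.+1
    + \sum_(i < N | (i != a) && (i != b)) f i * i.+1))%N.
  by rewrite site_sumE (bigD1 a) //= (bigD1 b).
rewrite !sumE !ffunE tpermL tpermR ja jb prednK //.
rewrite (eq_bigr (fun i : 'I_N => eta i * i.+1)%N) => [|i /andP[ia ib]].
  by move: (\sum_(_ < N | _) _)%N => S; case: (eta a); case: (eta b); lia.
by rewrite ffunE tpermD // eq_sym.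
Qed.

Definition weight (q : R) (eta : config N) : R := q ^- site_sum (occupied eta).

Hypotheses (htheta1 : 0 < theta1) (htheta2 : 0 < theta2).
Local Notation q := (theta1 / theta2).

(** Exchanging 10 for 01 has probability theta2 and multiplies the weight by
    q^-1 = theta2 / theta1; the reverse exchange has probability theta1. *)
Lemma detailed_balance j eta :
  weight q eta * exchange_prob j eta
  = weight q (exchange j eta) * exchange_prob j (exchange j eta).
Proof.
rewrite /exchange_prob; case: ifP => [hj|_]; last by rewrite !mulr0.
have := site_sum_exchange eta hj; rewrite /weight.
rewrite !ffunE tpermL tpermR.
have t1 : theta1 != 0 by rewrite gt_eqF.
have t2 : theta2 != 0 by rewrite gt_eqF.
move: (site_sum _) (site_sum _) => s s'.
case: (eta _); case: (eta _); rewrite ?mulr0 // addn0 addn1 => e;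
  [rewrite -e | rewrite e];
  by rewrite exprSr invfM; move: (q ^- _) => Q; field; rewrite t1 t2.
Qed.

(** Reversibility of a single exchange, together with the fact that exchanging is
    an involution of the configurations, gives invariance one step at a time. *)
Lemma exchange_chain_weight js tau' :
  \sum_eta weight q eta * exchange_chain js eta tau' = weight q tau'.
Proof.
elim: js => [|j js IH] /=.
  rewrite (bigD1 tau') //= eqxx mulr1 big1 ?addr0 // => eta /negbTE ->.
  by rewrite mulr0.
rewrite -{}[RHS]IH.
under eq_bigr => eta _ do rewrite mulrDr !mulrA detailed_balance.
rewrite big_split /=.
rewrite [X in _ + X](reindex_inj (inv_inj (exchangeK j))) /=.
rewrite -big_split /=; apply: eq_bigr => eta _.
by rewrite exchangeK; ring.
Qed.
End Exchange.

(** The sites of P are pairwise distinct, so placing a configuration on P and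
    reading it back changes nothing; the chain of exchanges along the sweep does
    the rest. *)
Lemma particle_system_exchange n (R : realFieldType) (theta1 theta2 : R) P
    (tau tau' : config n.+1) :
  down_right_path n.+1 P ->
  particle_system theta1 theta2 0 0 0 0 P tau tau'
  = exchange_chain theta1 theta2
      [seq (v.1 - v.2)%N | v <- sampled_vertices n.+1 P (shift 1 P)] tau tau'.
Proof.
move=> hP; have [_ line _] := path_facts hP.
rewrite /particle_system /transition.
rewrite (sampling_prob_exchange (tau' := tau') _ _ _ (path_sweep hP) line).
  congr exchange_chain; apply/ffunP=> i; rewrite ffunE /arrows_of_config.
  apply/existsP/idP => [[k /andP[/eqP e tk]]|ti]; last first.
    by exists i; rewrite outgoing_edge_crossing // eqxx.
  rewrite outgoing_edge_crossing // in e.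
  suff -> : i = k by [].
  by apply: val_inj; apply: (crossing_edge_inj line _ _ e).
move=> sigma; congr (_ == _); apply/ffunP=> i; rewrite !ffunE.
by rewrite outgoing_edge_crossing //; apply: shift_path.
Qed.

(** * Normalization of the stationary measures *)

Lemma card_occupied N (tau : config N) :
  #|occupied tau| = (\sum_(i < N) tau i)%N.
Proof.
rewrite -sum1_card big_mkcond; apply: eq_bigr => i _.
by rewrite inE; case: (tau i).
Qed.

Lemma partition_function_gt0 (R : realFieldType) N (q : R) k : 0 < q -> (k <= N)%N ->
  0 < \sum_(A : {set 'I_N} | #|A| == k) q ^- site_sum A.
Proof.
move=> q0 kN; have wpos (A : {set 'I_N}) : 0 < q ^- site_sum A.
  by rewrite invr_gt0 exprn_gt0.
have : (0 < #|[set A : {set 'I_N} | #|A| == k]|)%N.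
  by rewrite card_draws card_ord bin_gt0.
case/card_gt0P => A; rewrite inE => hA.
by rewrite (bigD1 A) //= ltr_wpDr // sumr_ge0 // => B _; apply: ltW.
Qed.

Lemma mu_k_prob (R : realFieldType) N (q : R) k : 0 < q -> (k <= N)%N ->
  prob_measure (@mu_k N R q k).
Proof.
move=> q0 kN; have Z0 := partition_function_gt0 q0 kN; split=> [tau|].
  rewrite /mu_k; case: ifP => // _; rewrite divr_ge0 ?ltW //.
  by rewrite invr_gt0 exprn_gt0.
rewrite -big_mkcond /= -mulr_suml.
have bij : {on [pred tau : config N | #|occupied tau| == k],
    bijective (fun A : {set 'I_N} => [ffun i => i \in A] : config N)}.
  exists (@occupied N) => [A _|tau _]; first by apply/setP=> i; rewrite inE ffunE.
  by apply/ffunP=> i; rewrite ffunE inE.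
rewrite (reindex _ bij) /=.
have occE (A : {set 'I_N}) : occupied ([ffun i => i \in A] : config N) = A.
  by apply/setP=> i; rewrite inE ffunE.
under eq_bigl => A do rewrite occE.
under eq_bigr => A _ do rewrite occE.
by rewrite mulfV ?gt_eqF.
Qed.

(** * Conservation and stationarity of the particle system *)

Theorem corollary2p13 (R : realFieldType) (N : nat) (theta1 theta2 : R)
    (hN : (1 <= N)%N)
    (htheta1 : 0 < theta1 <= 1) (htheta2 : 0 < theta2 <= 1) :
  (forall P : seq vertex, down_right_path N P ->
     forall tau tau' : config N,
       particle_system theta1 theta2 0 0 0 0 P tau tau' != 0 ->
       (\sum_(i < N) tau' i = \sum_(i < N) tau i)%N) /\
  (forall k : nat, (k <= N)%N ->
     forall P : seq vertex, down_right_path N P ->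
       (forall tau : config N, mu_k (theta1 / theta2) k tau != 0 ->
          (\sum_(i < N) tau i)%N = k) /\
       stationary (@particle_system N R theta1 theta2 0 0 0 0 P)
                  (@mu_k N R (theta1 / theta2) k)).
Proof.
case: N hN => // n _.
have [/andP[t1 _] /andP[t2 _]] := (htheta1, htheta2).
have conserved P : down_right_path n.+1 P -> forall tau tau' : config n.+1,
    particle_system theta1 theta2 0 0 0 0 P tau tau' != 0 ->
    (\sum_(i < n.+1) tau' i = \sum_(i < n.+1) tau i)%N.
  by move=> hP tau tau'; rewrite particle_system_exchange // => /exchange_chain_sum.
split=> // k kN P hP; split.
  move=> tau; rewrite /mu_k -card_occupied; case: ifP => [/eqP //|_].
  by rewrite eqxx.
split; first by apply: mu_k_prob => //; apply: divr_gt0.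
move=> tau'.
set Z := \sum_(A : {set 'I_n.+1} | #|A| == k) (theta1 / theta2) ^- site_sum A.
(* Since the number of particles is conserved, conditioning on k particles can be
   moved from the initial configuration to the final one. *)
transitivity ((if #|occupied tau'| == k then 1 else 0) / Z * \sum_tau
  weight (theta1 / theta2) tau * particle_system theta1 theta2 0 0 0 0 P tau tau').
  rewrite mulr_sumr; apply: eq_bigr => tau _.
  have [->|nz] := eqVneq (particle_system theta1 theta2 0 0 0 0 P tau tau') 0.
    by rewrite !mulr0.
  rewrite /mu_k !card_occupied (conserved P hP tau tau' nz) /weight -/Z.
  by case: ifP => _; ring.
under eq_bigr => tau _ do rewrite particle_system_exchange //.
rewrite exchange_chain_weight // /mu_k /weight -/Z.
by case: ifP => _; ring.
Qed.
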